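(* Let $Q=Q_1\times Q_2$, let $\Delta_{Q_1}\subset TQ_1$ and $\Delta_{Q_2}\subset TQ_2$ be constraint distributions with associated (+) discrete induced Dirac structures $D_{\Delta_{Q_1}}^{d+}$ and $D_{\Delta_{Q_2}}^{d+}$, and let $\Sigma_Q\subset TQ=T(Q_1\times Q_2)$ be an interconnection distribution with associated standard discrete interaction Dirac structure $D_{\mathrm{int}}^{d+}$. Assume that the constraint discretization is compatible. Then $$(D_{\Delta_{Q_1}}^{d+}\oplus D_{\Delta_{Q_2}}^{d+})\boxtimes_d D_{\mathrm{int}}^{d+}=D_{\Delta_Q}^{d+},$$ where $\Delta_Q=(\Delta_{Q_1}\oplus\Delta_{Q_2})\cap\Sigma_Q$.
   Context: Everything is in local coordinates: each configuration manifold $Q$ is represented by an open subset of its model vector space $V$, $T^*Q=Q\times V^*$ with elements $z=(q,p)$, and $Q\times Q^*$ means $Q\times V^*$. Elements of $T^*(Q\times Q^* )$ are written $(q,p,\alpha_q,\alpha_p)$ with base point $(q,p)$, $\alpha_q\in V^*$, $\alpha_p\in V$; covectors at the same base point are added and subtracted fiberwise. For $z=(q,p)$, $z^+=(q^+,p^+)$ put $\hat z=(q,p^+)$; $\alpha_{\hat z}$ denotes an element $(q,p^+,\alpha_q,\alpha_{p^+})$ of $T^*_{\hat z}(Q\times Q^* )$. For $Q=Q_1\times Q_2$ write $q=(q_1,q_2)$, $p=(p_1,p_2)$, etc. $\Delta^\circ$ denotes the annihilator of $\Delta$; $\pi_{Q_i}:Q\to Q_i$ is the projection, and $(\Delta_{Q_1}\oplus\Delta_{Q_2})(q)=\Delta_{Q_1}(q_1)\times\Delta_{Q_2}(q_2)$;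 intersections of distributions are fiberwise. Discrete constraint distributions. If $\Delta^\circ$ is spanned by one-forms $\{\omega^a\}$ on $Q$ and each is discretized to a function $\omega_{d+}^a:Q\times Q\to\mathbb{R}$ (e.g. $\omega_{d+}^a(q_0,q_1)=\omega^a(q_0)(R_{q_0}^{-1}(q_1))$ for a retraction $R:TQ\to Q$, i.e. a smooth map with $R_q(0_q)=q$, $T_{0_q}R_q=\mathrm{id}$), then $\Delta^{d+}=\{(q,q^+)\in Q\times Q: \omega_{d+}^a(q,q^+)=0\ \forall a\}$. Choice of one-forms and compatibility. Let $\{\omega_i^a\}_a$ be a basis of $\Delta_{Q_i}^\circ$, let $\tilde\omega_i^a(q)\cdot v_q=\omega_i^a(\pi_{Q_i}(q))\cdot T\pi_{Q_i}(v_q)$ be the extensions to $Q$, and let $\{\alpha^b\}_b$ be a basis of $\Sigma_Q^\circ$. $\Delta_{Q_i}^{d+}$ is defined using $\{\omega_i^a\}_a$, $\Sigma_Q^{d+}$ using $\{\alpha^b\}$, and $\Delta_Q^{d+}$ using the family $\{\tilde\omega_1^a,\tilde\omega_2^a,\alpha^b\}$, which spans $\Delta_Q^\circ$, with the same discretizations $\alpha^b_{d+}$. The discretization is compatible if $\tilde\omega_{d+,i}^a(q,q^+)=\omega_{d+,i}^a(q_i,q_i^+)$ for all $i,a$. (+) discrete induced Dirac structure of a distribution $\Delta_Q$ on $Q$: with $\Delta_{T^*Q}^{d+}=\{((q,p),(q^+,p^+))\in T^*Q\times T^*Q:(q,q^+)\in\Delta_Q^{d+}\}$, $\Delta_{Q\times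 Q^*}^\circ=\{(q,p,\alpha_q,0)\in T^*(Q\times Q^* ):\alpha_q\,dq\in\Delta_Q^\circ(q)\}$, and $\Omega_{d+}^\flat((q,p),(q^+,p^+))=(q,p^+,p,q^+)$, $$D_{\Delta_Q}^{d+}=\{((z,z^+),\alpha_{\hat z})\in(T^*Q\times T^*Q)\times T^*(Q\times Q^* ): (z,z^+)\in\Delta_{T^*Q}^{d+},\ \alpha_{\hat z}-\Omega_{d+}^\flat(z,z^+)\in\Delta_{Q\times Q^*}^\circ\}.$$ The same definition with $Q_i$ in place of $Q$ gives $D_{\Delta_{Q_i}}^{d+}$. Direct sum: $D_{\Delta_{Q_1}}^{d+}\oplus D_{\Delta_{Q_2}}^{d+}$ is the set of $((z,z^+),\alpha_{\hat z})\in(T^*Q\times T^*Q)\times T^*(Q\times Q^* )$, $\alpha_{\hat z}=(q_1,q_2,p_1^+,p_2^+,\alpha_{q_1},\alpha_{q_2},\alpha_{p_1},\alpha_{p_2})$, such that $((q_i,p_i,q_i^+,p_i^+),(q_i,p_i^+,\alpha_{q_i},\alpha_{p_i}))\in D_{\Delta_{Q_i}}^{d+}$ for $i=1,2$. Standard discrete interaction Dirac structure: with $\Sigma_{\mathrm{int}}^{d+}=\{((q,p),(q^+,p^+)):(q,q^+)\in\Sigma_Q^{d+}\}$, $\Sigma_{Q\times Q^*}^\circ=\{(q,p,\alpha_q,0):\alpha_q\,dq\in\Sigma_Q^\circ(q)\}$ and $\Omega_{\mathrm{int}}^{d+}(q,p,q^+,p^+)=(q,p^+,0,0)$, $$D_{\mathrm{int}}^{d+}=\{((z,z^+),\alpha_{\hat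 z}):(z,z^+)\in\Sigma_{\mathrm{int}}^{d+},\ \alpha_{\hat z}-\Omega_{\mathrm{int}}^{d+}(z,z^+)\in\Sigma_{Q\times Q^*}^\circ\}.$$ Discrete tensor product: for subsets $D_1,D_2\subset(T^*Q\times T^*Q)\times T^*(Q\times Q^* )$ all of whose elements have the form $((z,z^+),\alpha_{\hat z})$ with $z=(q,p)$, $z^+=(q^+,p^+)$, $\hat z=(q,p^+)$ and $\alpha_{\hat z}\in T^*_{\hat z}(Q\times Q^* )$, $$D_1\boxtimes_d D_2=\{((z,z^+),\alpha_{\hat z}):\exists\,\beta_{\hat z}\in T^*_{\hat z}(Q\times Q^* )\text{ with }((z,z^+),\alpha_{\hat z}+\beta_{\hat z})\in D_1,\ ((z,z^+),-\beta_{\hat z})\in D_2\}.$$ *)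

(* Defs.v *)
From HB Require Import structures.
From mathcomp Require Import all_boot all_order all_algebra.
From mathcomp Require Import all_classical all_reals all_analysis.

Set Implicit Arguments.
Unset Strict Implicit.
Unset Printing Implicit Defensive.

Import Order.TTheory GRing.Theory Num.Theory numFieldNormedType.Exports.

Local Open Scope classical_set_scope.
Local Open Scope ring_scope.

(* Finite-dimensional real vector spaces. All norms on such a space are
   equivalent: the norm is only there to give access to its canonical topology
   and differential calculus. *)
#[short(type="finNormedModType")]
HB.structure Definition FinNormedModule (R : realType) :=
  {V of NormedModule R V & Vector R V}.

HB.instance Definition _ (R : realType) (V1 V2 : finNormedModType R) :=
  Vector.on (V1 * V2)%type.

HB.instance Definition _ (R : realType) (m n : nat) :=
  Vector.on (matrix R m n).

Section SingleSpace.
Context {R : realType}.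
Implicit Types V : finNormedModType R.

Definition dual V := 'Hom(V, R^o).

(* All iterated directional derivatives, in all orders and directions, are
   Frechet differentiable (hence continuous) on Q. *)
Definition smooth_on V (Q : set V) (f : V -> R) : Prop :=
  forall (vs : seq V) (q : V), Q q ->
    differentiable (foldr (fun v g => 'D_v g) f vs) q.

(* Only the values of Delta on the configuration set Q are relevant; similarly
   for one-forms and discretized one-forms below. *)
Definition tangent_distribution V := V -> {vspace V}.

Definition annihilator V (U : {vspace V}) : set (dual V) :=
  [set alpha : dual V | forall v, v \in U -> alpha v = 0].

(* A finite family of one-forms omega^a, each with a discretization
   omega_{d+}^a, which may be any function. *)
Record discretized_forms V := DiscretizedForms {
  form_index : finType;
  one_form : form_index -> V -> dual V;
  dform : form_index -> V -> V -> R }.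

Definition smooth_forms V (Q : set V) (w : discretized_forms V) : Prop :=
  forall (a : form_index w) (v : V), smooth_on Q (fun q => one_form a q v).

Definition annihilator_basis V (Q : set V) (Delta : tangent_distribution V)
    (w : discretized_forms V) : Prop :=
  forall q, Q q ->
    let X := codom (fun a : form_index w => one_form a q) in
    free X /\ annihilator (Delta q) = [set alpha | alpha \in <<X>>%VS].

(* Delta^{d+}, as determined by the discretized one-forms w. *)
Definition discrete_distribution V (Q : set V) (w : discretized_forms V) :
    set (V * V) :=
  [set x | [/\ Q x.1, Q x.2 & forall a : form_index w, dform a x.1 x.2 = 0]].

(* cotangent V stands for T^*Q = Q x V^*, with elements (q, p).
   cotangent2 V stands for T^* (Q x Q^* ), with elements
   ((q, p), (alpha_q, alpha_p)); here alpha_p lies in V^** = V. *)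
Definition cotangent V : Type := (V * dual V)%type.
Definition cotangent2 V : Type := ((V * dual V) * (dual V * V))%type.

Definition hat V (z z' : cotangent V) : V * dual V := (z.1, z'.2).

(* Fiberwise operations; addc and subc are only meaningful when both arguments
   have the same base point. *)
Definition addc V (a b : cotangent2 V) : cotangent2 V := (a.1, a.2 + b.2).
Definition subc V (a b : cotangent2 V) : cotangent2 V := (a.1, a.2 - b.2).
Definition oppc V (a : cotangent2 V) : cotangent2 V := (a.1, - a.2).

(* Delta_{T^*Q}^{d+}, or Sigma_int^{d+} when w discretizes Sigma_Q. *)
Definition lifted_discrete_distribution V (Q : set V)
    (w : discretized_forms V) : set (cotangent V * cotangent V) :=
  [set x | discrete_distribution Q w (x.1.1, x.2.1)].

(* Delta_{Q x Q^*}^o. *)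
Definition lifted_annihilator V (Q : set V)
    (Delta : tangent_distribution V) : set (cotangent2 V) :=
  [set a | [/\ Q a.1.1, annihilator (Delta a.1.1) a.2.1 & a.2.2 = 0]].

Definition Omega_flat V (z z' : cotangent V) : cotangent2 V :=
  (hat z z', (z.2, z'.1)).

Definition Omega_int V (z z' : cotangent V) : cotangent2 V :=
  (hat z z', (0, 0)).

Definition discrete_structure V : Type :=
  set ((cotangent V * cotangent V) * cotangent2 V).

(* The equation a.1 = hat z z' says that a is a covector at the base point
   (q, p^+), where the subtraction takes place. *)
Definition induced_dirac V (Q : set V) (Delta : tangent_distribution V)
    (w : discretized_forms V) : discrete_structure V :=
  [set x | let: ((z, z'), a) := x in
    [/\ lifted_discrete_distribution Q w (z, z'),
        a.1 = hat z z' &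
        lifted_annihilator Q Delta (subc a (Omega_flat z z'))]].

Definition interaction_dirac V (Q : set V) (Sigma : tangent_distribution V)
    (w : discretized_forms V) : discrete_structure V :=
  [set x | let: ((z, z'), a) := x in
    [/\ lifted_discrete_distribution Q w (z, z'),
        a.1 = hat z z' &
        lifted_annihilator Q Sigma (subc a (Omega_int z z'))]].

Definition discrete_tensor V (D1 D2 : discrete_structure V) :
    discrete_structure V :=
  [set x | let: ((z, z'), a) := x in
    a.1 = hat z z' /\
    exists b : cotangent2 V,
      [/\ b.1 = hat z z',
          D1 ((z, z'), addc a b) &
          D2 ((z, z'), oppc b)]].

Definition interD V (Delta Sigma : tangent_distribution V) :
    tangent_distribution V :=
  fun q => (Delta q :&: Sigma q)%VS.

Definition union_forms V (w w' : discretized_forms V) : discretized_forms V :=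
  {| form_index := (form_index w + form_index w')%type;
     one_form := fun a =>
       match a with inl a => one_form a | inr a => one_form a end;
     dform := fun a =>
       match a with inl a => dform a | inr a => dform a end |}.

End SingleSpace.

Section Product.
Context {R : realType} {V1 V2 : finNormedModType R}.

(* The identification p = (p_1, p_2) of (V1 x V2)^* with V1^* x V2^*. *)
Definition dual_fst (p : dual (V1 * V2)%type) : dual V1 :=
  linfun (fun v : V1 => p (v, 0)).
Definition dual_snd (p : dual (V1 * V2)%type) : dual V2 :=
  linfun (fun v : V2 => p (0, v)).

Lemma dual_fstE p v : dual_fst p v = p (v, 0).
Proof.
rewrite /dual_fst.
pose f := (p \o (fun v : V1 => (v, 0) : V1 * V2))%FUN.
have fD : linear f.
  move=> a x y; rewrite /f /= -linearP; congr (p _).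
  by apply: injective_projections; rewrite /= ?scaler0 ?addr0.
pose g : {linear V1 -> R^o} := HB.pack f (GRing.isLinear.Build _ _ _ _ f fD).
exact: (lfunE g v).
Qed.

Lemma dual_sndE p v : dual_snd p v = p (0, v).
Proof.
rewrite /dual_snd.
pose f := (p \o (fun v : V2 => (0, v) : V1 * V2))%FUN.
have fD : linear f.
  move=> a x y; rewrite /f /= -linearP; congr (p _).
  by apply: injective_projections; rewrite /= ?scaler0 ?addr0.
pose g : {linear V2 -> R^o} := HB.pack f (GRing.isLinear.Build _ _ _ _ f fD).
exact: (lfunE g v).
Qed.

Definition cotangent_fst (z : cotangent (V1 * V2)%type) : cotangent V1 :=
  (z.1.1, dual_fst z.2).
Definition cotangent_snd (z : cotangent (V1 * V2)%type) : cotangent V2 :=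
  (z.1.2, dual_snd z.2).

Definition cotangent2_fst (a : cotangent2 (V1 * V2)%type) : cotangent2 V1 :=
  ((a.1.1.1, dual_fst a.1.2), (dual_fst a.2.1, a.2.2.1)).
Definition cotangent2_snd (a : cotangent2 (V1 * V2)%type) : cotangent2 V2 :=
  ((a.1.1.2, dual_snd a.1.2), (dual_snd a.2.1, a.2.2.2)).

Definition dirac_sum (D1 : discrete_structure V1)
    (D2 : discrete_structure V2) : discrete_structure (V1 * V2)%type :=
  [set x | let: ((z, z'), a) := x in
    [/\ a.1 = hat z z',
        D1 ((cotangent_fst z, cotangent_fst z'), cotangent2_fst a) &
        D2 ((cotangent_snd z, cotangent_snd z'), cotangent2_snd a)]].

(* Delta_1(q_1) x Delta_2(q_2); see mem_sumD. *)
Definition sumD (Delta1 : tangent_distribution V1)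
    (Delta2 : tangent_distribution V2) : tangent_distribution (V1 * V2)%type :=
  fun q => (linfun fst @^-1: Delta1 q.1 :&: linfun snd @^-1: Delta2 q.2)%VS.

Lemma mem_sumD Delta1 Delta2 q v :
  (v \in sumD Delta1 Delta2 q) = (v.1 \in Delta1 q.1) && (v.2 \in Delta2 q.2).
Proof. by rewrite memv_cap -!memv_preim !lfunE. Qed.

(* The extensions to Q1 x Q2 of the one-forms w on Q1 (resp. Q2), together with
   discretizations d of these extensions. *)
Definition extend_fst (w : discretized_forms V1)
    (d : form_index w -> V1 * V2 -> V1 * V2 -> R) :
    discretized_forms (V1 * V2)%type :=
  {| form_index := form_index w;
     one_form := fun a q => (one_form a q.1 \o linfun fst)%VF;
     dform := d |}.
Definition extend_snd (w : discretized_forms V2)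
    (d : form_index w -> V1 * V2 -> V1 * V2 -> R) :
    discretized_forms (V1 * V2)%type :=
  {| form_index := form_index w;
     one_form := fun a q => (one_form a q.2 \o linfun snd)%VF;
     dform := d |}.

Definition compatible_discretization (Q1 : set V1) (Q2 : set V2)
    (w1 : discretized_forms V1) (w2 : discretized_forms V2)
    (d1 : form_index w1 -> V1 * V2 -> V1 * V2 -> R)
    (d2 : form_index w2 -> V1 * V2 -> V1 * V2 -> R) : Prop :=
  forall q q' : V1 * V2, (Q1 `*` Q2) q -> (Q1 `*` Q2) q' ->
    (forall a, d1 a q q' = dform a q.1 q'.1) /\
    (forall a, d2 a q q' = dform a q.2 q'.2).

End Product.

(* Main.v *)
Require Import Defs.
From mathcomp Require Import all_boot all_order all_algebra.
From mathcomp Require Import all_classical all_reals all_analysis.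
Import GRing.Theory numFieldNormedType.Exports.

Local Open Scope classical_set_scope.
Local Open Scope ring_scope.

(** A witness [b] of membership in the tensor product lies, up to sign, in the
    lifted annihilator of [Sigma], so its only freedom is to shift [alpha_q] by
    an element of [Sigma^o]; the interaction structure has no other effect than
    this shift and its own discrete constraints.  Two facts then give the
    result.

    First, the direct sum of the induced structures of [Delta1] and [Delta2] is
    itself the induced structure, on the product, of [Delta1 x Delta2], with
    the extended one-forms ([dirac_sum_induced]).  Compatibility of the
    discretization gives the equality of the discrete constraints.  The fibre
    conditions agree because a covector kills a product of subspaces exactly
    when each of its two components kills the corresponding factor
    ([annihilator_sumD]).

    Secondly, on a single configuration space the tensor product of the induced
    structure of [Delta] with the interaction structure of [Sigma] is the
    induced structure of their intersection ([tensor_induced_interaction]).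
    The discrete constraints are just put together.  The fibre conditions say
    that [alpha_q - p] is the sum of an element of [Delta^o] and an element of
    [Sigma^o], and in finite dimension such sums are precisely the covectors
    that vanish on the intersection ([annihilator_capP]). *)

Section Annihilator.
Context {R : realType} {V : finNormedModType R}.

(** In the nontrivial direction, [beta] has to agree with [alpha] on [U] and to
    vanish on [W].  It is [alpha] composed with the projection of [U + W] onto a
    complement of [U :&: W] in [U], along [W]: this projection moves a vector
    of [U] by an element of [U :&: W], where [alpha] vanishes. *)
Lemma annihilator_capP (U W : {vspace V}) (alpha : dual V) :
  annihilator (U :&: W)%VS alpha <->
  exists2 beta, annihilator W beta & annihilator U (alpha - beta).
Proof.
split=> [alpha0|[beta betaW aU] v]; last first.
  rewrite memv_cap => /andP[vU vW].
  by have := aU v vU; rewrite add_lfunE opp_lfunE betaW// subr0.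
exists (alpha \o addv_pi1 U W)%VF => v vUW.
  have vE : addv_pi1 U W v + addv_pi2 U W v = v.
    by apply: addv_pi1_pi2; rewrite -[v]add0r memv_add ?mem0v.
  have piv0 : addv_pi1 U W v = 0.
    by apply: (addIr v); rewrite add0r -{2}(addv_pi2_id U vUW).
  by rewrite comp_lfunE piv0 linear0.
rewrite add_lfunE opp_lfunE comp_lfunE -linearB; apply: alpha0.
have vE : addv_pi1 U W v + addv_pi2 U W v = v.
  by apply: addv_pi1_pi2; rewrite -[v]addr0 memv_add ?mem0v.
have -> : v - addv_pi1 U W v = addv_pi2 U W v by rewrite -{1}vE addrC addKr.
rewrite memv_cap memv_pi2 andbT -[addv_pi2 _ _ _](addKr (addv_pi1 U W v)) vE.
by rewrite rpredD// rpredN memv_pi1.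
Qed.

End Annihilator.

Section Product.
Context {R : realType} {V1 V2 : finNormedModType R}.

Lemma dual_fstB (p p' : dual (V1 * V2)%type) :
  dual_fst (p - p') = dual_fst p - dual_fst p'.
Proof. by apply/lfunP => v; rewrite !(dual_fstE, add_lfunE, opp_lfunE). Qed.

Lemma dual_sndB (p p' : dual (V1 * V2)%type) :
  dual_snd (p - p') = dual_snd p - dual_snd p'.
Proof. by apply/lfunP => v; rewrite !(dual_sndE, add_lfunE, opp_lfunE). Qed.

Lemma annihilator_sumD (Delta1 : tangent_distribution V1)
    (Delta2 : tangent_distribution V2) (q : V1 * V2)
    (alpha : dual (V1 * V2)%type) :
  annihilator (sumD Delta1 Delta2 q) alpha <->
  annihilator (Delta1 q.1) (dual_fst alpha) /\
  annihilator (Delta2 q.2) (dual_snd alpha).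
Proof.
split=> [alpha0|[alpha1 alpha2] [v1 v2]].
  by split=> v vD; rewrite (dual_fstE, dual_sndE) alpha0// mem_sumD/= mem0v
    ?andbT.
rewrite mem_sumD => /andP[/= v1D v2D].
have -> : (v1, v2) = (v1, 0) + (0, v2) :> V1 * V2.
  by apply: injective_projections; rewrite /= (addr0, add0r).
have a1 := alpha1 v1 v1D; have a2 := alpha2 v2 v2D.
rewrite dual_fstE in a1; rewrite dual_sndE in a2.
by apply: etrans (linearD alpha _ _) (etrans (congr2 +%R a1 a2) (addr0 _)).
Qed.

Lemma discrete_distribution_extend (Q1 : set V1) (Q2 : set V2)
    (w1 : discretized_forms V1) (w2 : discretized_forms V2)
    (d1 : form_index w1 -> V1 * V2 -> V1 * V2 -> R)
    (d2 : form_index w2 -> V1 * V2 -> V1 * V2 -> R) (q q' : V1 * V2) :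
  compatible_discretization Q1 Q2 d1 d2 ->
  discrete_distribution (Q1 `*` Q2)
    (union_forms (extend_fst d1) (extend_snd d2)) (q, q') <->
  discrete_distribution Q1 w1 (q.1, q'.1) /\
  discrete_distribution Q2 w2 (q.2, q'.2).
Proof.
move=> compat; split.
  move=> [/= Qq Qq' d0]; have [e1 e2] := compat _ _ Qq Qq'.
  case: Qq Qq' => [q1 q2] [q1' q2']; split; split=> // a /=.
    by rewrite -e1; exact: (d0 (inl a)).
  by rewrite -e2; exact: (d0 (inr a)).
move=> [[/= q1 q1' c1] [/= q2 q2' c2]].
have [e1 e2] := compat q q' (conj q1 q2) (conj q1' q2').
by split=> // -[a|a] /=; rewrite (e1, e2).
Qed.

Arguments discrete_distribution_extend {Q1 Q2 w1 w2 d1 d2 q q'}.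

(** Both discrete constraints and fibre conditions split into their components
    on the two factors, so the direct sum is again an induced structure and the
    interconnection can be studied on a single space. *)
Lemma dirac_sum_induced (Q1 : set V1) (Q2 : set V2)
    (Delta1 : tangent_distribution V1) (Delta2 : tangent_distribution V2)
    (w1 : discretized_forms V1) (w2 : discretized_forms V2)
    (d1 : form_index w1 -> V1 * V2 -> V1 * V2 -> R)
    (d2 : form_index w2 -> V1 * V2 -> V1 * V2 -> R) :
  compatible_discretization Q1 Q2 d1 d2 ->
  dirac_sum (induced_dirac Q1 Delta1 w1) (induced_dirac Q2 Delta2 w2) =
  induced_dirac (Q1 `*` Q2) (sumD Delta1 Delta2)
    (union_forms (extend_fst d1) (extend_snd d2)).
Proof.
move=> compat; apply/seteqP; split=> -[[[q p] [q' p']] [[r s] [aq ap]]] /=.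
  move=> [[-> ->]] [D1 _ [/= Qq1 A1 ap1]] [D2 _ [/= Qq2 A2 ap2]].
  split=> //; first exact/(discrete_distribution_extend compat).
  split=> //=.
    by apply/annihilator_sumD; rewrite dual_fstB dual_sndB.
  exact: injective_projections.
move=> [/(discrete_distribution_extend compat)[D1 D2]] [-> ->].
move=> [/= [Qq1 Qq2] /annihilator_sumD].
rewrite dual_fstB dual_sndB => -[A1 A2] ap0.
by split=> //; split=> //; split=> //=; [have := congr1 fst ap0 | have := congr1 snd ap0].
Qed.

End Product.

Section Tensor.
Context {R : realType} {V : finNormedModType R}.

Lemma discrete_distribution_union (Q : set V) (w w' : discretized_forms V)
    (x : V * V) :
  discrete_distribution Q (union_forms w w') x <->
  discrete_distribution Q w x /\ discrete_distribution Q w' x.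
Proof.
split=> [[Qx Qx' d0]|[[Qx Qx' d0] [_ _ d0']]]; last by split=> // -[].
by split; split=> // a; [exact: (d0 (inl a))|exact: (d0 (inr a))].
Qed.

(** Once [b] is eliminated, the two fibre conditions become the decomposition
    of [alpha_q - p] given by [annihilator_capP]. *)
Lemma tensor_induced_interaction (Q : set V)
    (Delta Sigma : tangent_distribution V) (w w' : discretized_forms V) :
  discrete_tensor (induced_dirac Q Delta w) (interaction_dirac Q Sigma w') =
  induced_dirac Q (interD Delta Sigma) (union_forms w w').
Proof.
apply/seteqP; split=> -[[[q p] [q' p']] [[r s] [aq ap]]] /=.
  move=> [[-> ->]] [[[t u] [bq bp]]] [[-> ->]].
  move=> [D _ [/= Qq A ap0]] [D' _ [/= _ A' bp0]].
  move: bp0 A'; rewrite !subr0 => /eqP; rewrite oppr_eq0 => /eqP bp0 A'.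
  split=> //; first exact/discrete_distribution_union.
  split=> //=; last by rewrite -ap0 bp0 addr0.
  apply/annihilator_capP; exists (- bq) => //.
  by rewrite opprK addrAC.
move=> [/discrete_distribution_union[D D']] [-> ->].
move=> [/= Qq /annihilator_capP[beta betaS betaD] ap0]; split=> //.
(* The tensor product has [-b] in the interaction structure, hence the sign. *)
exists ((q, p'), (- beta, 0)); split=> //; split=> //; split=> //=.
- by rewrite addrAC.
- by rewrite addr0.
- by rewrite opprK subr0.
- by rewrite !oppr0 addr0.
Qed.

End Tensor.

Theorem theorem3 (R : realType) (V1 V2 : finNormedModType R)
    (Q1 : set V1) (Q2 : set V2)
    (Delta1 : tangent_distribution V1) (Delta2 : tangent_distribution V2)
    (Sigma : tangent_distribution (V1 * V2)%type)
    (omega1 : discretized_forms V1) (omega2 : discretized_forms V2)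
    (alpha : discretized_forms (V1 * V2)%type)
    (d1 : form_index omega1 -> V1 * V2 -> V1 * V2 -> R)
    (d2 : form_index omega2 -> V1 * V2 -> V1 * V2 -> R) :
  let Q := Q1 `*` Q2 in
  let DeltaQ := interD (sumD Delta1 Delta2) Sigma in
  let omegaQ := union_forms
    (union_forms (extend_fst d1) (extend_snd d2)) alpha in
  open Q1 -> open Q2 ->
  smooth_forms Q1 omega1 -> annihilator_basis Q1 Delta1 omega1 ->
  smooth_forms Q2 omega2 -> annihilator_basis Q2 Delta2 omega2 ->
  smooth_forms Q alpha -> annihilator_basis Q Sigma alpha ->
  compatible_discretization Q1 Q2 d1 d2 ->
  discrete_tensor
    (dirac_sum (induced_dirac Q1 Delta1 omega1) (induced_dirac Q2 Delta2 omega2))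
    (interaction_dirac Q Sigma alpha)
  = induced_dirac Q DeltaQ omegaQ.
Proof.
move=> Q DeltaQ omegaQ _ _ _ _ _ _ _ _ compat.
by rewrite (dirac_sum_induced _ _ _ _ _ _ _ _ compat) tensor_induced_interaction.
Qed.
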